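(* Let $m>2$ be an even integer, $n\ge 1$ an integer, and let $M_{2mn}=\langle a,b : a^m=b^{2n}=1,\ bab^{-1}=a^{-1}\rangle$ be the metacyclic group of order $2mn$. Let $\Gamma_{M_{2mn}}$ be its non-commuting graph. Then the spectrum of the distance Laplacian matrix $D^L(\Gamma_{M_{2mn}})$ (eigenvalues counted with multiplicity, multiplicities being added if two of the listed values coincide) consists of: (a) $0$ with multiplicity $1$; (b) $2n(m-1)$ with multiplicity $\frac{m}{2}$; (c) $2mn$ with multiplicity $\frac{(2n-1)m}{2}$; (d) $(3m-4)n$ with multiplicity $\left(\frac{m}{2}-1\right)2n-1$.
   Context: For a finite non-abelian group $G$ with centre $Z(G)$, the non-commuting graph $\Gamma_G$ is the simple undirected graph with vertex set $G\setminus Z(G)$, in which two distinct vertices $u,v$ are adjacent if and only if $uv\ne vu$. For a connected graph $H$, $d_{uv}$ denotes the length of a shortest path between $u$ and $v$; the distance matrix $D(H)$ has $(u,v)$-entry $d_{uv}$. The transmission of a vertex $v$ is $\sum_{u} d_{uv}$, and $Tr(H)$ is the diagonal matrix of vertex transmissions. The distance Laplacian matrix is $D^L(H)=Tr(H)-D(H)$. *)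

(* Defs.v *)
From HB Require Import structures.
From mathcomp Require Import all_boot all_order all_algebra all_fingroup all_solvable.
Set Implicit Arguments. Unset Strict Implicit. Unset Printing Implicit Defensive.
Import GRing.Theory Num.Theory.

Section Graph.
Variables (T : finType) (e : rel T).

Fixpoint ball (k : nat) (x : T) : {set T} :=
  match k with
  | 0 => [set x]
  | k'.+1 => ball k' x :|: [set y | [exists z in ball k' x, e z y]]
  end.

(* shortest-path distance: least k such that y is within k steps of x
   (equals #|T| if y is unreachable; irrelevant for connected graphs). *)
Definition gdist (x y : T) : nat := find (fun k => y \in ball k x) (iota 0 #|T|).
End Graph.

Section NonCommuting.
Variable gT : finGroupType.
Local Open Scope group_scope.

Definition nc_vertices (G : {group gT}) : {set gT} := G :\: 'Z(G).

(* adjacency of the non-commuting graph: distinct non-central vertices that do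
   not commute (non-commuting elements are automatically distinct) *)
Definition nc_adj (G : {group gT}) : rel gT :=
  fun u v => [&& u \in nc_vertices G, v \in nc_vertices G & u * v != v * u].

Local Close Scope group_scope.
Local Open Scope ring_scope.

Definition nc_dist_mx (R : nzRingType) (G : {group gT}) :
  'M[R]_#|nc_vertices G| :=
  \matrix_(i, j) (gdist (nc_adj G) (enum_val i) (enum_val j))%:R.

Definition nc_trans_mx (R : nzRingType) (G : {group gT}) :
  'M[R]_#|nc_vertices G| :=
  diag_mx (\row_i \sum_j nc_dist_mx R G i j).

Definition nc_distLap (R : nzRingType) (G : {group gT}) :
  'M[R]_#|nc_vertices G| := nc_trans_mx R G - nc_dist_mx R G.
End NonCommuting.

(* Main.v *)
(** [G] is non-abelian with an abelian subgroup [H = <a, b^2>] of index 2 and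
    centre [Z] of order [2n].  The centralizer of a non-central element of [H]
    is [H], and that of [x] outside [H] is the union of [Z] and [Z x].  So
    commutation is an equivalence relation on the vertices, with one class of
    size [mn - 2n] and [m/2] classes of size [2n]; the graph is complete
    multipartite and has diameter 2.  With [N] vertices and class sizes [s],
    [D^L = diag (N + s) - J - E], where [J] is the all-ones matrix and [E] the
    matrix of the equivalence relation.  Now [det (x - D^L)] is obtained from a
    diagonal determinant by rank-one updates: first the blocks of [E], then
    [J].  Each update is along an eigenvector of the matrix built so far. *)
Require Import Defs.
From HB Require Import structures.
From mathcomp Require Import all_boot all_order all_algebra all_fingroup all_solvable.
From mathcomp Require Import ring zify.
Set Implicit Arguments. Unset Strict Implicit. Unset Printing Implicit Defensive.
Import GRing.Theory Num.Theory.
Local Open Scope ring_scope.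

(** * Determinants under rank-one updates *)

(** Evaluates one bordered block determinant in two ways: by splitting off a triangular factor, and
    by multiplying with a triangular matrix of determinant [l]. *)
Lemma det_scalar_add_rank1 (R : comNzRingType) (n : nat) (l : R)
    (u : 'cV[R]_n) (v : 'rV[R]_n) :
  l * \det (l%:M + u *m v) = l ^+ n * (l + (v *m u) 0 0).
Proof.
have <-: \det (block_mx (1%:M : 'M_1) (- v) u l%:M) = \det (l%:M + u *m v).
  have ->: block_mx (1%:M : 'M_1) (- v) u l%:M =
      block_mx 1%:M 0 u 1%:M *m block_mx 1%:M (- v) 0 (l%:M + u *m v).
    by rewrite mulmx_block !mul1mx !mul0mx !mulmx1 !addr0 mulmxN addrCA addNr addr0.
  by rewrite det_mulmx det_lblock det_ublock !det1 !mul1r.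
rewrite -[X in X * _](_ : \det (block_mx (l%:M : 'M_1) 0 (- u) 1%:M) = l); last first.
  by rewrite det_lblock det1 mulr1 det_scalar1.
rewrite mulrC -det_mulmx mulmx_block ?mul1mx ?mulmx0 ?mulmx1 ?mul0mx ?add0r.
have ->: u *m l%:M + l%:M *m - u = 0.
  by rewrite mul_mx_scalar mul_scalar_mx scalerN subrr.
rewrite det_ublock det_scalar mulNmx mulmxN opprK [l%:M + _]mx11_scalar.
by rewrite det_scalar1 !mxE mulrC eqxx.
Qed.

(** As [u] is an eigenvector, [l *: (A + u *m v)] factors as [A *m (l%:M + u *m v)], so no inverse
    of [A] enters. *)
Lemma det_add_rank1_eigen (R : idomainType) (n : nat) (A : 'M[R]_n) (l : R)
    (u : 'cV[R]_n) (v : 'rV[R]_n) :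
  l != 0 -> A *m u = l *: u ->
  l * \det (A + u *m v) = \det A * (l + (v *m u) 0 0).
Proof.
move=> l0 Au; apply: (mulfI (expf_neq0 n l0)).
rewrite mulrCA -detZ.
have ->: l *: (A + u *m v) = A *m (l%:M + u *m v).
  by rewrite mulmxDr mul_mx_scalar mulmxA Au -scalemxAl scalerDr.
by rewrite det_mulmx mulrCA det_scalar_add_rank1 mulrCA.
Qed.

Definition fiber_col (R : nzRingType) (n : nat) (K : finType) (f : 'I_n -> K)
  (c : K) : 'cV[R]_n := \col_i (f i == c)%:R.

Lemma fiber_col_dot (R : nzRingType) (n : nat) (K : finType) (f : 'I_n -> K)
    (c c' : K) :
  (fiber_col R f c)^T *m fiber_col R f c' =
    ((c == c')%:R * #|[pred i | f i == c]|%:R)%:M.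
Proof.
apply/matrixP=> i j; rewrite !ord1 !mxE eqxx mulr1n.
have [<-|cc'] := eqVneq c c'; last first.
  rewrite mul0r big1 // => k _; rewrite !mxE.
  by case: eqP => [->|]; rewrite ?(negPf cc') ?mulr0 ?mul0r.
rewrite mul1r -sum1_card natr_sum [RHS]big_mkcond /=.
by apply: eq_bigr => k _; rewrite !mxE inE; case: eqP; rewrite ?mulr1 ?mulr0.
Qed.

(** Induction on [r]: the blocks already added vanish on the indicator column of a new class, which
    thus stays an eigenvector for [g c]. Its own block then raises one factor [g c] by the class
    size. *)
Lemma det_diag_add_blocks (R : idomainType) (n : nat) (K : finType)
    (f : 'I_n -> K) (g : K -> R) (r : seq K) :
  (forall c, g c != 0) -> uniq r ->
  \det (diag_mx (\row_i g (f i))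
        + \sum_(c <- r) fiber_col R f c *m (fiber_col R f c)^T)
    * \prod_(c <- r) g c
  = (\prod_i g (f i)) * \prod_(c <- r) (g c + #|[pred i | f i == c]|%:R).
Proof.
move=> g0; elim: r => [|c r IHr] /=.
  by move=> _; rewrite !big_nil addr0 det_diag; under eq_bigr do rewrite mxE.
case/andP=> cr /IHr {}IHr; rewrite !big_cons.
set B := \sum_(c <- r) _ in IHr *.
have eigB: (diag_mx (\row_i g (f i)) + B) *m fiber_col R f c =
    g c *: fiber_col R f c.
  rewrite mulmxDl [B *m _]mulmx_suml big_seq big1 ?addr0 => [|c' c'r]; last first.
    rewrite -mulmxA fiber_col_dot; have [c'E|_] := eqVneq c' c.
      by rewrite -c'E c'r in cr.
    by rewrite mul0r mul_mx_scalar scale0r.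
  apply/matrixP=> i j; rewrite mul_diag_mx !mxE.
  by case: eqP => [->|]; rewrite ?mulr0.
rewrite [_ *m _ + B]addrC addrA [_ * (g c * _)]mulrA [_ * g c]mulrC.
rewrite (det_add_rank1_eigen _ (g0 c) eigB) fiber_col_dot eqxx mul1r.
rewrite [_%:M 0 0]mxE eqxx mulr1n mulrAC IHr.
by rewrite -mulrA [X in _ * X]mulrC.
Qed.

(** * Distance Laplacians of complete multipartite shape *)

Lemma char_poly_multipartite (R : idomainType) (n : nat) (K : finType)
    (f : 'I_n -> K) (M : 'M[R]_n) :
  let s c := #|[pred i | f i == c]| in
  (forall i j, M i j =
     (n + s (f i))%:R *+ (i == j) - 1 - (f i == f j)%:R) ->
  char_poly M * ('X - n%:R%:P)
  = 'X * ('X - n%:R%:P) ^+ #|f @: 'I_n|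
      * \prod_(c in f @: 'I_n) ('X - (n + s c)%:R%:P) ^+ (s c).-1.
Proof.
move=> s ME; set C := f @: 'I_n.
pose g c : {poly R} := 'X - (n + s c)%:R%:P.
have g0 c : g c != 0 by rewrite polyXsubC_eq0.
(* This value does not depend on [c], which makes the all-ones column an eigenvector of [A]. *)
have gD c : g c + (s c)%:R = 'X - n%:R%:P.
  by rewrite /g natrD polyCD opprD addrA !polyC_natr addrNK.
pose A := diag_mx (\row_i g (f i))
  + \sum_(c <- enum C) fiber_col {poly R} f c *m (fiber_col {poly R} f c)^T.
have AE i j : A i j = g (f i) *+ (i == j) + (f i == f j)%:R.
  rewrite !mxE summxE big_enum /= (bigD1 (f i)) /=; last exact: imset_f.
  rewrite big1 => [|c /andP[_ /negPf cfi]].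
    by rewrite !mxE big_ord1 !mxE eqxx mul1r addr0 [f j == _]eq_sym.
  by rewrite !mxE big_ord1 !mxE eq_sym cfi mul0r.
have eigA : A *m const_mx 1 = ('X - n%:R%:P) *: (const_mx 1 : 'cV_n).
  apply/matrixP=> i k; rewrite !mxE mulr1 -(gD (f i)).
  under eq_bigr do rewrite AE mxE mulr1.
  rewrite big_split /= (bigD1 i) //= eqxx mulr1n big1 ?addr0; last first.
    by move=> j /negPf ji; rewrite eq_sym ji.
  congr (_ + _); rewrite -natr_sum; congr _%:R.
  rewrite /s -sum1_card [RHS]big_mkcond /=.
  by apply: eq_bigr => j _; rewrite inE eq_sym; case: eqP.
have charE : char_poly M = \det (A + const_mx 1 *m (const_mx 1 : 'rV_n)).
  congr (\det _); apply/matrixP=> i j; rewrite [RHS]mxE AE !mxE big_ord1 !mxE mulr1 ME.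
  rewrite !rmorphB rmorphMn /= rmorph1 !polyC_natr /g.
  by case: eqP => [->|_]; rewrite ?mulr1n ?mulr0n ?polyC_natr; ring.
have gP0 : \prod_(c in C) g c != 0 by apply/prodf_neq0.
apply: (mulIf gP0); rewrite charE [\det _ * _]mulrC.
rewrite (det_add_rank1_eigen _ (negbT (polyXsubC_eq0 _)) eigA).
have -> : ((const_mx 1 : 'rV_n) *m (const_mx 1 : 'cV_n)) 0 0 = n%:R :> {poly R}.
  by rewrite mxE; under eq_bigr do rewrite !mxE mulr1; rewrite sumr_const card_ord.
(* The all-ones update raises the eigenvalue ['X - n] by [n]; the result ['X] is the factor for the
   eigenvalue 0. *)
rewrite polyC_natr subrK mulrAC -[\prod_(c in C) _]big_enum.
rewrite (det_diag_add_blocks f g0 (enum_uniq _)) !big_enum /=.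
have -> : \prod_(c in C) (g c + (s c)%:R) = ('X - n%:R) ^+ #|C|.
  by under eq_bigr do rewrite gD polyC_natr; rewrite prodr_const.
(* One factor per class is split off to match the product by which both sides were multiplied;
   classes are nonempty, so the predecessor is exact. *)
have -> : \prod_(i < n) g (f i) = \prod_(c in C) (g c * g c ^+ (s c).-1).
  rewrite (partition_big_imset f) /=; apply: eq_bigr => c /imsetP[i _ ->].
  rewrite -exprS prednK; last by apply/card_gt0P; exists i; rewrite inE.
  rewrite (eq_bigr (fun=> g (f i))) => [|j /eqP -> //].
  by rewrite prodr_const.
by rewrite big_split /=; ring.
Qed.

(** * Distances 0, 1 and 2 in a graph *)

Lemma gdist_refl (T : finType) (e : rel T) (x : T) : gdist e x x = 0%N.
Proof.
rewrite /gdist (_ : #|T| = #|T|.-1.+1); last first.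
  by rewrite prednK //; apply/card_gt0P; exists x.
by rewrite /= inE eqxx.
Qed.

Lemma gdist_adj (T : finType) (e : rel T) (x y : T) :
  x != y -> e x y -> gdist e x y = 1%N.
Proof.
(* The search runs over [iota 0 #|T|], so radius 1 is tried only if [T] has two elements. *)
move=> xy exy; have T2 : (1 < #|T|)%N.
  by have := subset_leq_card (subsetT [set x; y]); rewrite cards2 xy cardsT.
rewrite /gdist -(subnKC T2) /= !inE eq_sym (negPf xy).
by rewrite (_ : [exists z in _, _]) //; apply/exists_inP; exists x; rewrite ?inE.
Qed.

Lemma gdist_two (T : finType) (e : rel T) (x z y : T) :
  [/\ x != y, x != z & z != y] -> ~~ e x y -> e x z -> e z y -> gdist e x y = 2%N.
Proof.
(* Three distinct points bring radius 2 into the search range. *)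
move=> [xy xz zy] nexy exz ezy; have T3 : (2 < #|T|)%N.
  have := subset_leq_card (subsetT (y |: [set x; z])).
  by rewrite cardsU1 cards2 cardsT xz !inE ![y == _]eq_sym (negPf xy) (negPf zy).
rewrite /gdist -(subnKC T3) /= !inE eq_sym (negPf xy) /=.
have -> /= : [exists u in [set x], e u y] = false.
  by apply/exists_inP => -[u /set1P ->]; apply/negP.
rewrite (_ : [exists u in _, _]) //; apply/exists_inP; exists z => //.
by rewrite !inE; apply/orP; right; apply/exists_inP; exists x; rewrite ?inE.
Qed.

(** * Groups whose commuting vertices share their centralizer *)

Section CommutationTransitive.
Variables (R : idomainType) (gT : finGroupType) (G : {group gT}).
Local Notation V := (nc_vertices G).
Hypothesis commE : {in V &, forall x y, (x * y == y * x)%g = ('C_G[x] == 'C_G[y])%g}.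

Lemma nc_noncommuting (x : gT) :
  x \in V -> exists2 z, z \in V & (x * z != z * x)%g.
Proof.
rewrite inE => /andP[xZ xG].
have /subsetPn[z zG zx] : ~~ (G \subset 'C[x]%g).
  by rewrite sub_cent1; apply: contra xZ => xC; rewrite inE xG.
have nxz : (x * z != z * x)%g by apply: contra zx => /eqP xz; apply/cent1P.
exists z => //; rewrite inE zG andbT; apply: contra nxz => /centerP[_ /(_ x xG) /eqP].
by rewrite eq_sym.
Qed.

(** One equation covers distances 0, 1 and 2; the term in [x == y] stands on the left to avoid
    truncated subtraction. *)
Lemma gdist_nc (x y : gT) : x \in V -> y \in V ->
  (gdist (nc_adj G) x y + 2 * (x == y) = 1 + ('C_G[x] == 'C_G[y])%g)%N.
Proof.
move=> xV yV; have [<-|xy] := eqVneq x y; first by rewrite gdist_refl eqxx.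
rewrite -(commE xV yV); case: (boolP (x * y == y * x)%g) => cxy; last first.
  by rewrite gdist_adj // /nc_adj xV yV cxy.
(* Since [x] and [y] have the same centralizer, [z] fails to commute with both and is a common
   neighbour. *)
have [z zV nxz] := nc_noncommuting xV.
have nzy : (z * y != y * z)%g.
  by move: nxz cxy; rewrite !commE // => nxz /eqP <-; rewrite eq_sym.
rewrite (@gdist_two _ _ x z y) //; rewrite /nc_adj ?xV ?yV ?zV ?cxy //.
by split=> //; [move: nxz|move: nzy]; apply: contraNneq => ->.
Qed.

(** The distance matrix is [J + E - 2 I], so the transmissions are [N + s - 2], and the 2 cancels in
    the difference. *)
Lemma nc_distLapE (i j : 'I_#|V|) :
  nc_distLap R G i j =
    (#|V| + #|[pred k : 'I_#|V| | 'C_G[enum_val k]%g == 'C_G[enum_val i]%g]|)%:R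
      *+ (i == j) - 1 - ('C_G[enum_val i]%g == 'C_G[enum_val j]%g)%:R.
Proof.
have dE k l : nc_dist_mx R G k l =
    1 + ('C_G[enum_val k]%g == 'C_G[enum_val l]%g)%:R - 2 *+ (k == l).
  rewrite mxE; apply/eqP; rewrite eq_sym subr_eq eq_sym; apply/eqP.
  have /(congr1 (fun k => k%:R : R)) := gdist_nc (enum_valP k) (enum_valP l).
  by rewrite natrD natrM mulr_natr [in RHS]natrD (inj_eq enum_val_inj).
rewrite mxE [_ (- _) _ _]mxE mxE mxE dE.
under eq_bigr do rewrite dE.
rewrite sumrB big_split /= sumr_const card_ord -natr_sum.
have -> : \sum_(k < #|V|) 2 *+ (i == k) = 2 :> R.
  rewrite (bigD1 i) //= eqxx big1 ?addr0 // => k /negPf ki.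
  by rewrite eq_sym ki.
have -> : (\sum_(k < #|V|) ('C_G[enum_val i]%g == 'C_G[enum_val k]%g) =
    #|[pred k : 'I_#|V| | 'C_G[enum_val k]%g == 'C_G[enum_val i]%g]|)%N.
  rewrite -[RHS]sum1_card [RHS]big_mkcond /=.
  by apply: eq_bigr => k _; rewrite inE eq_sym; case: eqP.
rewrite natrD; case: eqP => _; rewrite ?mulr1n ?mulr0n; ring.
Qed.

End CommutationTransitive.

(** * Non-abelian groups with an abelian subgroup of index 2 *)

Section AbelianIndexTwo.
Local Open Scope group_scope.
Variables (gT : finGroupType) (G H : {group gT}).
Hypotheses (sHG : H \subset G) (iHG : #|G : H| = 2).
Hypotheses (cHH : abelian H) (ncG : ~~ abelian G).
Local Notation V := (nc_vertices G).

Lemma sub_join_outside (x : gT) : x \in G :\: H -> G \subset H <*> <[x]>.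
Proof.
move=> xGH; have [xG xH] := setDP xGH; apply/subsetP=> g gG.
have [gH|gH] := boolP (g \in H); first exact: (subsetP (joing_subl _ _)).
have: g \in H :* x by rewrite (rcoset_index2 sHG iHG xGH) inE gH.
case/rcosetP=> h hH ->; apply: groupM.
  exact: (subsetP (joing_subl _ _)).
exact: (subsetP (joing_subr _ _) _ (cycle_id x)).
Qed.

(** A central element outside [H] would generate with [H] all of [G], making it abelian. *)
Lemma center_sub_abelian_index2 : 'Z(G) \subset H.
Proof.
apply/subsetP=> z /centerP[zG zC]; apply: contraR ncG => zH.
have zGH : z \in G :\: H by rewrite inE zH.
apply: abelianS (sub_join_outside zGH) _.
rewrite abelianY cHH cycle_abelian cycle_subG /=.
by apply/centP=> h hH; apply: zC; apply: (subsetP sHG).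
Qed.

(** An element of [H] commuting with [x] centralizes both [H] and [x], which generate [G]. *)
Lemma cent1_inside_outside (x : gT) : x \in G :\: H -> 'C_H[x] = 'Z(G).
Proof.
move=> xGH; have [xG xH] := setDP xGH; apply/setP=> h; apply/idP/idP; last first.
  move=> hZ; rewrite inE (subsetP center_sub_abelian_index2) //=.
  by have /centerP[_ /(_ x xG) hx] := hZ; apply/cent1P.
case/setIP=> hH /cent1P hx; rewrite inE (subsetP sHG) //=.
rewrite -sub_cent1; apply: subset_trans (sub_join_outside xGH) _.
rewrite join_subG cycle_subG; apply/andP; split; last exact/cent1P.
by rewrite sub_cent1 (subsetP cHH).
Qed.

(** Any [u] outside [H] commuting with [x] would put [x] into ['C_H[u]], which is the centre. *)
Lemma cent1_inside (x : gT) : x \in H -> x \notin 'Z(G) -> 'C_G[x] = H.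
Proof.
move=> xH xZ; apply/eqP; rewrite eqEsubset andbC subsetI sHG sub_cent1.
rewrite (subsetP cHH) //=; apply/subsetP=> u /setIP[uG ux].
apply: contraR xZ => uH; rewrite -(@cent1_inside_outside u) ?in_setD ?uH //.
by rewrite in_setI xH cent1C.
Qed.

(** A non-central [u] commuting with [x] lies outside [H], so [u = h * x] with [h] in [H]; then [h]
    commutes with [x] and is central. *)
Lemma cent1_outside (x : gT) : x \in G :\: H -> 'C_G[x] :\: 'Z(G) = 'Z(G) :* x.
Proof.
move=> xGH; have [xG xH] := setDP xGH; have xZH := cent1_inside_outside xGH.
apply/setP=> u; apply/setDP/rcosetP => [[/setIP[uG ux] uZ]|[z zZ ->]].
  have uH : u \notin H by apply: contra uZ => uH; rewrite -xZH inE uH.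
  have: u \in H :* x by rewrite (rcoset_index2 sHG iHG xGH) inE uH.
  case/rcosetP=> h hH uE; exists h => //; rewrite -xZH inE hH.
  by rewrite -(groupMr _ (cent1id x)) -uE.
split.
  rewrite in_setI groupM ?(subsetP (center_sub G) z) //= groupM ?cent1id //.
  by move: zZ; rewrite -xZH => /setIP[].
rewrite groupMl //; apply: contra xH; apply/subsetP.
exact: center_sub_abelian_index2.
Qed.

(** For [x] in [H] both centralizers are [H]; otherwise [y] is a central multiple of [x], which
    leaves the centralizer unchanged. *)
Lemma nc_commuteE :
  {in V &, forall x y, (x * y == y * x) = ('C_G[x] == 'C_G[y])}.
Proof.
move=> x y /setDP[xG xZ] /setDP[yG yZ].
apply/eqP/eqP => [xy|/setP/(_ y)]; last first.
  by rewrite !in_setI yG cent1id => /cent1P.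
have yCx : y \in 'C_G[x] by rewrite inE yG; apply/cent1P.
have [xH|xH] := boolP (x \in H).
  by rewrite !cent1_inside // -(cent1_inside xH xZ).
have: y \in 'Z(G) :* x by rewrite -cent1_outside in_setD ?yZ ?xH.
case/rcosetP=> z /centerP[zG zC] ->; apply/setP=> u; rewrite !in_setI.
case uG: (u \in G) => //=; rewrite ![u \in _]cent1C; rewrite groupMl //.
by apply/cent1P; apply: zC.
Qed.

Lemma nc_class_card (x : gT) : x \in V ->
  #|[set y in V | 'C_G[y] == 'C_G[x]]| =
    if x \in H then (#|H| - #|'Z(G)|)%N else #|'Z(G)|.
Proof.
move=> xV; have [xG xZ] := setDP xV.
have -> : [set y in V | 'C_G[y] == 'C_G[x]] = 'C_G[x] :\: 'Z(G).
  apply/setP=> y; rewrite inE; have [yV|] := boolP (y \in V); last first.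
    by rewrite !inE negb_and => /orP[/negPf->|/negPf->]; rewrite ?andbF.
  have [yG yZ] := setDP yV; rewrite -(nc_commuteE yV xV) [RHS]in_setD yZ in_setI yG /=.
  by apply/eqP/cent1P.
have [xH|xH] := ifPn.
  by rewrite cent1_inside // cardsD (setIidPr center_sub_abelian_index2).
by rewrite cent1_outside ?card_rcoset // inE xH.
Qed.

Lemma card_nc_vertices : #|V| = (2 * #|H| - #|'Z(G)|)%N.
Proof.
by rewrite cardsD (setIidPr (center_sub G)) -(Lagrange sHG) iHG mulnC.
Qed.

(** Ensures that [H] contributes a nonempty class. A central [H] and one outside element would
    generate an abelian [G]. *)
Lemma proper_center_abelian_index2 : 'Z(G) \proper H.
Proof.
rewrite properE center_sub_abelian_index2 /=; apply: contra ncG => HZ.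
have /subsetPn[x xG xH] : ~~ (G \subset H).
  by rewrite -indexg_eq1 iHG.
have xGH : x \in G :\: H by rewrite inE xH.
apply: abelianS (sub_join_outside xGH) _.
rewrite abelianY cHH cycle_abelian cycle_subG /=.
by apply/centP=> h /(subsetP HZ)/centerP[_ /(_ x xG)].
Qed.

Lemma nc_fiber_card (i : 'I_#|V|) :
  #|[pred k : 'I_#|V| | 'C_G[enum_val k] == 'C_G[enum_val i]]| =
    if enum_val i \in H then (#|H| - #|'Z(G)|)%N else #|'Z(G)|.
Proof.
rewrite -(nc_class_card (enum_valP i)) -[LHS]sum1_card -[RHS]sum1_card /=.
rewrite -(big_enum_val_cond (fun y => 'C_G[y] == 'C_G[enum_val i]) (fun=> 1%N)).
by apply: eq_bigl => y; rewrite [RHS]inE.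
Qed.

Local Close Scope group_scope.

Lemma char_poly_nc_distLap_index2 (R : idomainType) :
  let h := #|H| in let z := #|'Z(G)%g| in let k := (h %/ z)%N in
  char_poly (nc_distLap R G) =
    'X * ('X - (2 * h - z)%:R%:P) ^+ k
       * ('X - (2 * h)%:R%:P) ^+ (k * (z - 1))
       * ('X - (3 * h - 2 * z)%:R%:P) ^+ (h - z - 1).
Proof.
move=> h z k.
have zh : (z < h)%N by apply: proper_card proper_center_abelian_index2.
have z0 : (0 < z)%N by apply: cardG_gt0.
pose f (i : 'I_#|V|) := 'C_G[enum_val i]%g.
pose s c := #|[pred i | f i == c]|.
pose C := f @: 'I_#|V|.
have charE : char_poly (nc_distLap R G) * ('X - #|V|%:R%:P)
    = 'X * ('X - #|V|%:R%:P) ^+ #|C|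
        * \prod_(c in C) ('X - (#|V| + s c)%:R%:P) ^+ (s c).-1.
  exact: char_poly_multipartite (nc_distLapE R nc_commuteE).
have [x xH xZ] : exists2 x, x \in H & x \notin 'Z(G)%g.
  by apply/subsetPn; have := proper_center_abelian_index2; rewrite properE => /andP[].
have xV : x \in V by rewrite in_setD xZ (subsetP sHG).
(* Classes are labelled by centralizers, so the class of [H] minus the centre has [H] itself as its
   label. *)
have HE : (H : {set gT}) = f (enum_rank_in xV x).
  by rewrite /f enum_rankK_in // cent1_inside.
have HC : (H : {set gT}) \in C by rewrite HE imset_f.
have sH : s H = (h - z)%N by rewrite HE /s nc_fiber_card enum_rankK_in // xH.
have sD c : c \in C -> c != H -> s c = z.
  case/imsetP=> i _ ->; rewrite /s nc_fiber_card; case: ifP => // iH.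
  by rewrite /f cent1_inside ?eqxx //; have /setDP[] := enum_valP i.
pose D := [pred c in C | c != H].
have CE : #|C| = #|D|.+1.
  rewrite (cardD1 (H : {set gT})) HC add1n; congr _.+1.
  by apply: eq_card => c; rewrite !inE andbC.
(* Counting vertices by class gives [h - z + #|D| * z = 2 * h - z], hence [#|D| * z = h]. *)
have kE : #|D| = k.
  have : (\sum_(c in C) s c = #|V|)%N.
    rewrite -[RHS]card_ord -[RHS]sum1_card (partition_big_imset f) /=.
    by apply: eq_bigr => c _; rewrite -[LHS]sum1_card.
  rewrite (bigD1 (H : {set gT})) //= sH card_nc_vertices.
  rewrite (eq_bigr (fun=> z)) => [|c /andP[]]; last exact: sD.
  rewrite (sum_nat_const D) -/h -/z => kzE.
  have arith a b c : (b < a -> a - b + c = 2 * a - b -> a = c)%N by lia.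
  have hE : h = (#|D| * z)%N by apply: arith zh kzE.
  by rewrite /k [in RHS]hE mulnK.
(* The auxiliary factor takes up one of the [k.+1] factors ['X - #|V|], leaving the exponent [k]. *)
apply: (mulIf (negbT (polyXsubC_eq0 #|V|%:R))); rewrite charE CE kE.
rewrite (bigD1 (H : {set gT})) //= sH.
rewrite (eq_bigr (fun=> ('X - (#|V| + z)%:R%:P) ^+ z.-1)); last first.
  by move=> c /andP[cC cH]; rewrite (sD c cC cH).
rewrite (prodr_const D) kE.
have -> : #|V| = (2 * h - z)%N by apply: card_nc_vertices.
rewrite -!subn1 -exprM [((z - 1) * k)%N]mulnC.
have -> : (2 * h - z + z = 2 * h)%N by lia.
have -> : (2 * h - z + (h - z) = 3 * h - 2 * z)%N by lia.
rewrite exprS; ring.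
Qed.

End AbelianIndexTwo.

(** * Structure of the metacyclic group *)

Section Metacyclic.
Local Open Scope group_scope.
Variables (gT : finGroupType) (G : {group gT}) (a b : gT) (m n : nat).
Hypotheses (m2 : (2 < m)%N) (n0 : (0 < n)%N).
Hypotheses (GE : G :=: <<[set a; b]>>) (am : a ^+ m = 1) (bn : b ^+ (2 * n) = 1).
Hypotheses (bab : b * a * b^-1 = a^-1) (cardG : #|G| = (2 * m * n)%N).
Local Notation H := (<[a]> <*> <[b ^+ 2]>)%G.

(** Here [a ^ b] is [b^-1 * a * b], while the relation conjugates by [b^-1]; inversion is an
    involution, so both act alike. *)
Lemma metacyclic_conj : a ^ b = a^-1.
Proof.
have abV : a ^ b^-1 = a^-1 by rewrite conjgE invgK mulgA.
by apply: invg_inj; rewrite invgK -conjVg -abV conjgKV.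
Qed.

Lemma metacyclic_join : G :=: <[a]> * <[b]>.
Proof.
rewrite GE -norm_joinEr; first by rewrite joing_idl joing_idr.
rewrite cycle_subG inE -cycleJ metacyclic_conj cycleV.
by rewrite subxx.
Qed.

(** The relations bound the orders by [m] and [2 * n]; the product formula and the given order of
    [G] then force equality throughout. *)
Lemma metacyclic_orders : [/\ #[a] = m, #[b] = (2 * n)%N & <[a]> :&: <[b]> = 1].
Proof.
have am_le : (#[a] <= m)%N by apply: dvdn_leq; [lia | rewrite order_dvdn am].
have bn_le : (#[b] <= 2 * n)%N by apply: dvdn_leq; [lia | rewrite order_dvdn bn].
have := mul_cardG <[a]> <[b]>; rewrite -metacyclic_join cardG -!orderE => cE.
have c0 : (0 < #|<[a]> :&: <[b]>|)%N := cardG_gt0 _.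
have arith x y c : (x <= m -> y <= 2 * n -> x * y = 2 * m * n * c -> 0 < c ->
    [/\ x = m, y = 2 * n & c = 1])%N.
  move=> xm yn xyE c_gt0; have xy_le : (x * y <= m * (2 * n))%N := leq_mul xm yn.
  have c1 : c = 1%N by nia.
  by rewrite c1 in xyE *; split; nia.
by have [-> -> /card1_trivg] := arith _ _ _ am_le bn_le cE c0.
Qed.

Lemma metacyclic_nonabelian : ~~ abelian G.
Proof.
have [oa _ _] := metacyclic_orders.
have [aG bG] : a \in G /\ b \in G by rewrite GE !mem_gen // !inE eqxx ?orbT.
apply/negP => /centsP/(_ a aG b bG) ab.
have : a ^+ 2 = 1.
  have : a ^ b = a by rewrite /conjg ab mulKg.
  by rewrite metacyclic_conj => aV; rewrite expgS expg1 -[X in X * _]aV mulVg.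
by move/eqP; rewrite -order_dvdn oa => /dvdn_leq; lia.
Qed.

(** Conjugation by [b] inverts [a], so applying it twice fixes [a]. *)
Lemma metacyclic_b2_cent : <[b ^+ 2]> \subset 'C(<[a]>).
Proof.
rewrite cent_cycle cycle_subG cent1C; apply/cent1P/commgP/conjg_fixP.
by rewrite expgS expg1 conjgM metacyclic_conj conjVg metacyclic_conj invgK.
Qed.

Lemma metacyclic_TI_b2 : <[a]> :&: <[b ^+ 2]> = 1.
Proof.
have [_ _ abI] := metacyclic_orders.
by apply/trivgP; rewrite -abI setIS ?cycle_subG ?mem_cycle.
Qed.

Lemma metacyclic_card_b2 : #|<[b ^+ 2]>| = n.
Proof.
have [_ ob _] := metacyclic_orders.
by rewrite -orderE orderXdiv ob ?dvdn_mulr // mulKn.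
Qed.

Lemma metacyclic_index2E : (H : {set gT}) = <[a]> * <[b ^+ 2]>.
Proof. by apply: cent_joinEr; apply: metacyclic_b2_cent. Qed.

Lemma metacyclic_card_index2 : #|H| = (m * n)%N.
Proof.
have [oa _ _] := metacyclic_orders.
by rewrite metacyclic_index2E TI_cardMg ?metacyclic_TI_b2 // metacyclic_card_b2 -orderE oa.
Qed.

Lemma metacyclic_abelian_index2 : [/\ H \subset G, #|G : H| = 2 & abelian H].
Proof.
have sHG : H \subset G.
  by rewrite join_subG !cycle_subG groupX // GE mem_gen ?inE ?eqxx ?orbT.
split=> //.
  rewrite -divgS // cardG metacyclic_card_index2 -mulnA mulnK // muln_gt0; lia.
rewrite abelianY !cycle_abelian /=; exact: metacyclic_b2_cent.
Qed.

Hypothesis evenm : ~~ odd m.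

(** A power of [a] commutes with [b] exactly when it equals its inverse, so the cyclic intersection
    has order dividing 2. *)
Lemma metacyclic_card_cent : #|<[a]> :&: 'C[b]| = 2.
Proof.
have [oa _ _] := metacyclic_orders.
have [c cE] : exists c, <[a]> :&: 'C[b] = <[c]>.
  by apply/cyclicP; apply: cyclicS (subsetIl _ _) (cycle_cyclic a).
have inC i : (a ^+ i \in 'C[b]) = (m %| 2 * i)%N.
  rewrite -oa mulnC order_dvdn expgM expgS expg1 -[in RHS]eq_invg_mul.
  rewrite -expgVn -metacyclic_conj -conjXg.
  by apply/cent1P/eqP => [/commgP/conjg_fixP|/conjg_fixP/commgP].
have c2 : (#[c] %| 2)%N.
  have /setIP[/cycleP[i cEi]] : c \in <[a]> :&: 'C[b] by rewrite cE cycle_id.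
  by rewrite cEi inC order_dvdn -expgM -oa order_dvdn mulnC.
have c1 : #[c] != 1%N.
  (* As [m] is even, [a ^+ m./2] is a nontrivial element of the intersection. *)
  rewrite order_eq1; apply: contraTneq (_ : a ^+ m./2 \in <[c]>) => [c1|]; last first.
    by rewrite -cE in_setI mem_cycle inC mul2n even_halfK ?dvdnn.
  rewrite c1 cycle1 inE -order_dvdn oa; apply/negP => /dvdn_leq; lia.
rewrite cE -orderE; move: c1; have := dvdn_leq (isT : 0 < 2)%N c2.
by have := order_gt0 c; case: #[c] => [|[|[|]]].
Qed.

(** The centre is ['C_H[b]]. Since [b ^+ 2] commutes with [b], the modular law splits it into [<[a]>
    :&: 'C[b]] of order 2 and [<[b ^+ 2]>] of order [n]. *)
Lemma metacyclic_card_center : #|'Z(G)| = (2 * n)%N.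
Proof.
have [sHG iHG cHH] := metacyclic_abelian_index2.
have bGH : b \in G :\: H.
  have bG : b \in G by rewrite GE mem_gen ?inE ?eqxx ?orbT.
  rewrite in_setD bG andbT; apply/negP=> bH.
  have : G \subset H.
    rewrite GE gen_subG; apply/subsetP=> x /set2P[]-> //.
    by apply: (subsetP (joing_subl _ _)); apply: cycle_id.
  by rewrite -indexg_eq1 iHG.
rewrite -(cent1_inside_outside sHG iHG cHH metacyclic_nonabelian bGH).
rewrite metacyclic_index2E setIC -group_modr; last first.
  by rewrite cycle_subG groupX ?cent1id.
rewrite setIC TI_cardMg ?metacyclic_card_cent ?metacyclic_card_b2 //.
by apply/trivgP; rewrite -metacyclic_TI_b2 setSI ?subsetIl.
Qed.

End Metacyclic.

Theorem theorem6p4 (R : realFieldType) (gT : finGroupType) (G : {group gT})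
    (a b : gT) (m n : nat) :
  ~~ odd m -> (2 < m)%N -> (0 < n)%N ->
  G :=: <<[set a; b]>>%g ->
  (a ^+ m = 1)%g -> (b ^+ (2 * n) = 1)%g -> (b * a * b^-1 = a^-1)%g ->
  #|G| = (2 * m * n)%N ->
  char_poly (nc_distLap R G) =
    'X
    * ('X - ((2 * n * (m - 1))%N%:R)%:P) ^+ (m %/ 2)%N
    * ('X - ((2 * m * n)%N%:R)%:P) ^+ ((2 * n - 1) * m %/ 2)%N
    * ('X - (((3 * m - 4) * n)%N%:R)%:P) ^+ ((m %/ 2 - 1) * (2 * n) - 1)%N.
Proof.
move=> evenm m2 n0 GE am bn bab cardG.
have [sHG iHG cHH] := metacyclic_abelian_index2 m2 n0 GE am bn bab cardG.
have ncG := metacyclic_nonabelian m2 n0 GE am bn bab cardG.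
(* Specialises to [h = m * n] and [z = 2 * n]; what remains is arithmetic, where evenness makes the
   halves of [m] exact. *)
rewrite (char_poly_nc_distLap_index2 sHG iHG cHH ncG).
rewrite (metacyclic_card_index2 m2 n0 GE am bn bab cardG).
rewrite (metacyclic_card_center m2 n0 GE am bn bab cardG evenm).
have mE : m = (2 * (m %/ 2))%N by lia.
have -> : (m * n %/ (2 * n) = m %/ 2)%N by rewrite divnMr.
have -> : (2 * n * (m - 1) = 2 * (m * n) - 2 * n)%N by nia.
have -> : ((2 * n - 1) * m %/ 2 = m %/ 2 * (2 * n - 1))%N.
  by rewrite [in LHS]mE mulnCA mulKn // mulnC.
have -> : ((3 * m - 4) * n = 3 * (m * n) - 2 * (2 * n))%N by nia.
have -> : ((m %/ 2 - 1) * (2 * n) = m * n - 2 * n)%N by nia.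
by rewrite -mulnA.
Qed.
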